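(* Let $\lambda>0$ and assume that $\Gamma:[0,\infty)\to\mathbb{R}$, $\Gamma(s)=\int_s^\infty \mathbb{E}[g(X_t,t)g(X_s,s)]\,dt$, is a non-negative, strictly decreasing, smooth function. Consider the optimization problem $$\inf_{Q\in\mathcal{M}(\mathbb{R}^+)}\left\{2\int_0^\infty\frac{\Gamma(s)}{Q(N>s)}\,ds+\lambda\int_0^\infty Q(N>s)\,ds\right\}.$$ Let $s^*=\inf\{s\in[0,\infty):\ \Gamma(s)\le\lambda/2\}$. Then the infimum is attained at the distribution $Q^*\in\mathcal{M}(\mathbb{R}^+)$ given by $$Q^*(N>s)=\begin{cases}1 & \text{for } 0\le s<s^*,\\ \sqrt{\dfrac{2\Gamma(s)}{\lambda}} & \text{for } s\ge s^*,\end{cases}$$ and the minimum value is $$2\int_0^{s^*}\Gamma(s)\,ds+2\sqrt{2\lambda}\int_{s^*}^\infty\sqrt{\Gamma(s)}\,ds+\lambda s^*.$$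
   Context: $X=\{X_t:t\ge0\}$ is a stochastic process on a metric space $\mathcal{X}$, and $g:\mathcal{X}\times\mathbb{R}_+\to\mathbb{R}$ is such that $(t,\omega)\mapsto g(X_t(\omega),t)$ is jointly measurable. Standing integrability assumption: $\mathbb{E}\big[\big(\int_0^\infty|g(X_s,s)|\,ds\big)^2\big]<\infty$, and the integral defining $\Gamma(s)$ converges absolutely for every $s\ge0$. $\mathcal{M}(\mathbb{R}^+)$ denotes the set of probability distributions $Q$ of a real random variable $N$ with $Q(N\ge0)=1$ and $Q(N>s)>0$ for all $s\in[0,\infty)$. Infima and integrals of non-negative functions take values in $[0,\infty]$. *)

(* Defs.v *)
(* MathComp-Analysis development. *)
From HB Require Import structures.
From mathcomp Require Import all_boot all_order all_algebra.
From mathcomp Require Import all_classical all_reals all_analysis.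

Set Implicit Arguments.
Unset Strict Implicit.
Unset Printing Implicit Defensive.

Import Order.TTheory GRing.Theory Num.Theory.
Import numFieldNormedType.Exports.

Local Open Scope classical_set_scope.
Local Open Scope ring_scope.

(* Time is encoded by R; here and below, functions of time are constrained on
   [0, +oo[ only, so that their values at negative times are irrelevant. *)
Definition stochastic_process (R : realType) (d : measure_display)
    (Omega : measurableType d) (S : metricType R) (X : R -> Omega -> S) : Prop :=
  forall t : R, 0 <= t ->
    forall B : set S, <<s @open S >> B -> measurable (X t @^-1` B).

Definition jointly_measurable (R : realType) (d : measure_display)
    (Omega : measurableType d) (S : Type) (X : R -> Omega -> S)
    (g : S -> R -> R) : Prop :=
  measurable_fun ((`[0, +oo[ : set (measurableTypeR R)) `*` [set: Omega])
    (fun p : (measurableTypeR R * Omega)%type => g (X p.1 p.2) p.1).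

Definition square_integrable_total (R : realType) (d : measure_display)
    (Omega : measurableType d) (P : probability Omega R) (S : Type)
    (X : R -> Omega -> S) (g : S -> R -> R) : Prop :=
  (\int[P]_w ((\int[lebesgue_measure]_(s in `[0%R, +oo[) `|g (X s w) s|%:E) ^+ 2) < +oo)%E.

(* E[g(X_t, t) g(X_s, s)], in the extended reals; it is infinite when the
   product is not integrable. *)
Definition correlation (R : realType) (d : measure_display)
    (Omega : measurableType d) (P : probability Omega R) (S : Type)
    (X : R -> Omega -> S) (g : S -> R -> R) (t s : R) : \bar R :=
  ('E_P[fun w => (g (X t w) t * g (X s w) s)%R])%E.

Definition Gamma_converges (R : realType) (d : measure_display)
    (Omega : measurableType d) (P : probability Omega R) (S : Type)
    (X : R -> Omega -> S) (g : S -> R -> R) : Prop :=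
  forall s : R, 0 <= s ->
    lebesgue_measure.-integrable `[s, +oo[ (fun t : R => correlation P X g t s).

(* Under Gamma_converges, for 0 <= s, the integral is finite, and fine loses nothing. *)
Definition Gamma (R : realType) (d : measure_display)
    (Omega : measurableType d) (P : probability Omega R) (S : Type)
    (X : R -> Omega -> S) (g : S -> R -> R) (s : R) : R :=
  fine (\int[lebesgue_measure]_(t in `[s, +oo[) correlation P X g t s)%E.

(* Infinitely differentiable on [0, +oo[, with one-sided derivatives at 0;
   D n is the n-th derivative. *)
Definition smooth_halfline (R : realType) (f : R -> R) : Prop :=
  exists D : nat -> R -> R,
    (forall x : R, 0 <= x -> D 0%N x = f x) /\
    (forall (n : nat) (x : R), 0 <= x ->
      (D n y - D n x) / (y - x) @[y --> within `[0, +oo[ x^'] --> D n.+1 x).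

(* Laws Q on R, i.e. distributions of a real random variable N, with
   Q(N >= 0) = 1 and Q(N > s) > 0 for all s >= 0. *)
Definition Mplus (R : realType) : set (probability (measurableTypeR R) R) :=
  [set Q | Q `[0%R, +oo[%classic = 1%E /\
           forall s : R, 0 <= s -> (0 < Q `]s, +oo[%classic)%E].

Definition objective (R : realType) (lambda : R) (G : R -> R)
    (Q : probability (measurableTypeR R) R) : \bar R :=
  (2%:E * \int[lebesgue_measure]_(s in `[0%R, +oo[) (G s / fine (Q `]s, +oo[%classic))%:E
   + lambda%:E * \int[lebesgue_measure]_(s in `[0%R, +oo[) Q `]s, +oo[%classic)%E.

(* For G = Gamma P X g strictly decreasing and square_integrable_total P X g,
   G is integrable, hence tends to 0, so this set is nonempty and inf is the genuine
   infimum. *)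
Definition s_star (R : realType) (lambda : R) (G : R -> R) : R :=
  inf [set s : R | 0 <= s /\ G s <= lambda / 2].

(* Main.v *)
(** For fixed [s], AM-GM and the constraint [Q(N > s) <= 1] show that
    [y = min 1 (sqrt (2 G(s) / lambda))] minimizes [2 G(s) / y + lambda y] over
    ]0, 1].  As [G] is decreasing, these pointwise minimizers form a survival
    function, which is right-continuous because [G] is, and tends to 0 at
    infinity because [G] does.  The last fact comes from integrability: [G(s)] is
    at most [k(s) = E(|g(X_s, s)| * A)], where [A] is the integral of
    [|g(X_t, t)|] over time, and by Tonelli the integral of [k] is [E(A^2)],
    which is finite. *)

Require Import Defs.
From HB Require Import structures.
From mathcomp Require Import all_boot all_order all_algebra.
From mathcomp Require Import all_classical all_reals all_analysis.
From mathcomp Require Import measurable_realfun.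
From mathcomp Require Import ring lra.

Import Order.TTheory GRing.Theory Num.Theory.
Import numFieldNormedType.Exports.

Local Open Scope classical_set_scope.
Local Open Scope ring_scope.

(** * Small values of [Gamma] from square integrability *)

Section correlation_decay.
Context (R : realType) (d : measure_display) (Omega : measurableType d)
  (P : probability Omega R) (S : metricType R) (X : R -> Omega -> S)
  (g : S -> R -> R).
Hypothesis mg : jointly_measurable X g.
Local Open Scope ereal_scope.

Let rays : set (measurableTypeR R * Omega) := `[0%R, +oo[ `*` [set: Omega].
(** Extension by zero to negative times, so that Tonelli applies on the full product space. *)
Let f : measurableTypeR R * Omega -> R := (fun p => g (X p.1 p.2) p.1) \_ rays.
Let af (p : measurableTypeR R * Omega) : \bar R := `|f p|%:E.

Let fE t w : (0 <= t)%R -> f (t, w) = g (X t w) t.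
Proof.
by move=> t0; rewrite /f patchE mem_set//; split=> //=; rewrite in_itv/= t0.
Qed.

Let mf : measurable_fun setT f.
Proof.
apply: (measurable_restrictT _ _).1; last exact: mg.
by apply: measurableX => //; exact: measurable_itv.
Qed.

Let maf : measurable_fun [set: measurableTypeR R * Omega] af.
Proof. by apply/measurable_EFinP; exact: measurableT_comp. Qed.

Let af0 p : 0 <= af p. Proof. by rewrite lee_fin. Qed.

Let mafs s : measurable_fun setT (fun w => af (s, w)).
Proof. exact: measurableT_comp maf (pair1_measurable s). Qed.

Let A w : \bar R := \int[lebesgue_measure]_t af (t, w).

Let mA : measurable_fun setT A.
Proof. exact: measurable_fun_fubini_tonelli_G. Qed.

Let A0 w : 0 <= A w. Proof. by apply: integral_ge0 => t _. Qed.

Let k s : \bar R := \int[P]_w (af (s, w) * A w).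

Let mfA :
  measurable_fun [set: measurableTypeR R * Omega] (fun p => af p * A p.2).
Proof.
by apply: emeasurable_funM => //; apply: (measurableT_comp mA); exact: measurable_snd.
Qed.

Let mk : measurable_fun setT k.
Proof. by apply: (measurable_fun_fubini_tonelli_F _ mfA) => p; exact: mule_ge0. Qed.

Let k0 s : 0 <= k s. Proof. by apply: integral_ge0 => w _; exact: mule_ge0. Qed.

(** After Tonelli the inner integral is over time, where the factor [A w] is constant; pulling it
    out leaves [A w * A w]. *)
Let integral_k : \int[lebesgue_measure]_s k s =
  \int[P]_w ((\int[lebesgue_measure]_(s in `[0%R, +oo[) `|g (X s w) s|%:E) ^+ 2).
Proof.
have fA0 p : 0 <= af p * A p.2 by exact: mule_ge0.
have := fubini_tonelli1 (m1 := lebesgue_measure) (m2 := P) _ mfA fA0.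
rewrite (fubini_tonelli2 _ mfA fA0) /fubini_F /fubini_G /= => <-.
apply: eq_integral => w _.
rewrite ge0_integralZr//; last exact: measurableT_comp maf (pair2_measurable w).
suff -> : \int[lebesgue_measure]_(s in `[0%R, +oo[) `|g (X s w) s|%:E = A w
  by [].
rewrite integral_mkcond; apply: eq_integral => t _.
rewrite patchE /af; case: ifPn => [|t0].
  by rewrite inE/= in_itv/= andbT => /fE ->.
rewrite /f patchE ifF ?normr0//; apply/negP; rewrite inE => -[/= t1 _].
by move: t0; rewrite notin_setE.
Qed.

(** The absolute value goes inside both integrals, the time domain grows from [[s, +oo[] to the
    whole line, and Tonelli then gives [k s]. *)
Let Gamma_le_k s :
  Gamma_converges P X g -> (0 <= s)%R -> (Gamma P X g s)%:E <= k s.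
Proof.
move=> cG s0; have /integrableP[mc _] := cG s s0.
have cE t : (0 <= t)%R ->
    `|correlation P X g t s| <= \int[P]_w (af (t, w) * af (s, w)).
  move=> t0; rewrite /correlation unlock.
  have mts : measurable_fun setT (fun w => (f (t, w) * f (s, w))%R).
    by apply: measurable_funM; apply: measurableT_comp mf (pair1_measurable _).
  under eq_integral do rewrite -!fE//.
  apply: le_trans; first apply: le_abse_integral => //.
    exact/measurable_EFinP.
  by under eq_integral do rewrite abse_EFin normrM EFinM.
have mff :
    measurable_fun [set: measurableTypeR R * Omega] (fun p => af p * af (s, p.2)).
  apply: emeasurable_funM => //.
  by apply: (measurableT_comp (mafs s)); exact: measurable_snd.
have ff0 (p : measurableTypeR R * Omega) : 0 <= af p * af (s, p.2).
  exact: mule_ge0.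
have mF := measurable_fun_fubini_tonelli_F (m2 := P) _ mff ff0.
have F0 t : 0 <= \int[P]_w (af (t, w) * af (s, w)).
  by apply: integral_ge0 => w _; exact: mule_ge0.
have kE : k s = \int[lebesgue_measure]_t \int[P]_w (af (t, w) * af (s, w)).
  have := fubini_tonelli1 (m1 := lebesgue_measure) (m2 := P) _ mff ff0.
  rewrite (fubini_tonelli2 _ mff ff0) /fubini_F /fubini_G /= => <-.
  apply: eq_integral => w _.
  rewrite ge0_integralZr//; last exact: measurableT_comp maf (pair2_measurable w).
  by rewrite muleC.
have Gk : `| \int[lebesgue_measure]_(t in `[s, +oo[) correlation P X g t s| <= k s.
  apply: (le_trans (le_abse_integral _ _ mc)) => //; rewrite kE.
  apply: (@le_trans _ _ (\int[lebesgue_measure]_(t in `[s, +oo[)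
      \int[P]_w (af (t, w) * af (s, w)))).
    apply: ge0_le_integral => //.
    - exact: measurableT_comp.
    - exact: measurable_funTS.
    - by move=> t; rewrite /= in_itv/= andbT => st; apply: cE; exact: le_trans st.
  exact: ge0_subset_integral.
apply: le_trans Gk; rewrite /Gamma.
(* A real number is at most its absolute value; at an infinite value [fine] returns 0 while the
   absolute value is [+oo]. *)
case: (\int[lebesgue_measure]_(t in `[s, +oo[) _) => [r| |] /=;
  by rewrite ?lee_fin ?ler_norm ?leey.
Qed.

(** Otherwise the constant [e] would lie below [k] on a half-line of infinite length, although [k]
    has finite integral. *)
Lemma Gamma_arbitrarily_small (e : R) : square_integrable_total P X g ->
  Gamma_converges P X g -> (0 < e)%R ->
  exists2 s, (0 <= s)%R & (Gamma P X g s < e)%R.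
Proof.
move=> sq cG e0; apply: contrapT => nex.
have : \int[lebesgue_measure]_(s in `[0%R, +oo[)
    (cst e%:E) (s : measurableTypeR R) < +oo.
  apply: le_lt_trans sq; rewrite -integral_k.
  apply: (@le_trans _ _ (\int[lebesgue_measure]_(s in `[0%R, +oo[) k s)).
    apply: ge0_le_integral => //.
    - by move=> *; rewrite lee_fin ltW.
    - exact: measurable_funTS.
    - move=> s; rewrite /= in_itv/= andbT => s0.
      apply: le_trans (Gamma_le_k s cG s0); rewrite lee_fin leNgt.
      by apply/negP => ?; apply: nex; exists s.
  exact: ge0_subset_integral.
have Loo : lebesgue_measure (`[0%R, +oo[ : set R) = +oo.
  by rewrite lebesgue_measure_itv/= ltry addye.
rewrite integral_cst// [X in _ * X]Loo.
by rewrite mulr_infty gtr0_sg// mul1e ltxx.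
Qed.

End correlation_decay.

(** * Right continuity, the threshold and the pointwise minimizer *)

(** The difference quotient has a finite limit, so its product with [y - x] tends to 0. *)
Lemma smooth_halfline_right_cvg (R : realType) (f : R -> R) (x : R) :
  smooth_halfline f -> 0 <= x -> f y @[y --> x^'+] --> f x.
Proof.
move=> [D [D0 D1]] x0.
have sub : x^'+ `=>` within `[0, +oo[ x^'.
  move=> A; rewrite /within /dnbhs /at_right /within /=.
  apply: (@filterS _ (nbhs x) _) => y yA xy.
  apply: yA; first by rewrite gt_eqF.
  by rewrite in_itv/= andbT (le_trans x0 (ltW xy)).
have := cvg_trans (cvg_app _ sub) (D1 0%N x x0) => q.
have yx0 : y - x @[y --> x^'+] --> (0 : R).
  rewrite -(subrr x); apply: cvgB; last exact: cvg_cst.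
  by apply: (@cvg_at_right_filter R R (fun y => y)); exact: cvg_id.
have fx : f x + (D 0%N y - D 0%N x) / (y - x) * (y - x) @[y --> x^'+] --> f x.
  rewrite -[X in _ --> X]addr0 -[X in _ --> _ + X](mulr0 (D 1%N x)).
  by apply: cvgD; [exact: cvg_cst|exact: cvgM].
apply: cvg_trans fx; apply: near_eq_cvg.
near=> y.
have xy : x < y by near: y; exact: nbhs_right_gt.
rewrite /= !D0 ?(le_trans x0 (ltW xy))// mulfVK; first by rewrite addrC subrK.
by rewrite subr_eq0 gt_eqF.
Unshelve. all: by end_near. Qed.

(** By monotonicity the sublevel set contains every point beyond its infimum, and right continuity
    adds the infimum itself. Hence, at times [s >= 0], the tests [s < s0] and [lambda / 2 < G s]
    agree. *)
Lemma s_star_properties (R : realType) (lambda : R) (G : R -> R) :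
  (forall s t : R, 0 <= s -> s < t -> G t < G s) ->
  (forall x : R, 0 <= x -> G y @[y --> x^'+] --> G x) ->
  (exists2 s : R, 0 <= s & G s < lambda / 2) ->
  let s0 := s_star lambda G in
  [/\ 0 <= s0, forall s, 0 <= s -> s < s0 -> lambda / 2 < G s
    & forall s, s0 <= s -> G s <= lambda / 2].
Proof.
move=> decG rcG [u u0 Gu] s0.
pose E := [set s : R | 0 <= s /\ G s <= lambda / 2].
have Enonempty : E !=set0 by exists u; split=> //; exact: ltW.
have lbE : lbound E 0 by move=> s [].
have s0_ge0 : 0 <= s0 by exact: lb_le_inf.
have above s : s0 < s -> G s <= lambda / 2.
  move=> /(inf_lt Enonempty)[t [t0 Gt] ts].
  by rewrite (le_trans _ Gt)// ltW// decG.
split=> // [s s_ge0 ss0|s]; last first.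
  rewrite le_eqVlt => /orP[/eqP <-|]; last exact: above.
  apply: (cvgr_to_le (rcG _ s0_ge0)).
  by near=> y; apply: above; near: y; exact: nbhs_right_gt.
rewrite ltNge; apply/negP => Gs; move: ss0; apply/negP; rewrite -leNgt.
by apply: ge_inf; [exists 0|].
Unshelve. all: by end_near. Qed.

(** In each case the difference of the two sides factors with a visible sign. For [v = 1] the factor
    [2 * G - lambda * y] is non-negative because [y <= 1]; otherwise a square appears. *)
Lemma optimal_survival_pointwise (R : realType) (lambda G y : R) :
  0 < lambda -> 0 < G -> 0 < y -> y <= 1 ->
  let v := if lambda / 2 < G then 1 else Num.sqrt (2 * G / lambda) in
  2 * (G / v) + lambda * v <= 2 * (G / y) + lambda * y.
Proof.
move=> l0 G0 y0 y1; rewrite /= -subr_ge0.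
have [big|small] := ltP (lambda / 2) G.
  have -> : 2 * (G / y) + lambda * y - (2 * (G / 1) + lambda * 1) =
            (1 - y) * (2 * G - lambda * y) / y by field; rewrite gt_eqF.
  by rewrite divr_ge0 ?(ltW y0)// mulr_ge0 ?subr_ge0//; nra.
set r := Num.sqrt _.
have r0 : 0 < r by rewrite sqrtr_gt0 divr_gt0// mulr_gt0.
(* With [G] expressed through [r], the identity below becomes rational and [field] can prove it. *)
have GE : G = lambda * r ^+ 2 / 2.
  by rewrite sqr_sqrtr ?divr_ge0 ?mulr_ge0 ?ltW//; field; rewrite gt_eqF.
have -> : 2 * (G / y) + lambda * y - (2 * (G / r) + lambda * r) =
          lambda * (r - y) ^+ 2 / y by rewrite GE; field; rewrite !gt_eqF.
by rewrite divr_ge0 ?(ltW y0)// mulr_ge0 ?sqr_ge0// ltW.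
Qed.

(** * Laws with a prescribed survival function *)

(** The law is the Lebesgue-Stieltjes measure of [F]; the limits 0 and 1 make it a probability. *)
Lemma ccdf_realization (R : realType) (F : R -> R) :
  nondecreasing_fun F -> right_continuous F ->
  F @ -oo --> (0 : R) -> F @ +oo --> (1 : R) ->
  exists Q : probability (measurableTypeR R) R,
    forall s, Q `]s, +oo[%classic = (1 - F s)%:E.
Proof.
move=> ndF rcF F0 F1.
pose FC := isCumulative.Build R _ R F ndF rcF.
pose FB := isCumulativeBounded.Build R 0 1 F F0 F1.
pose f : cumulativeBounded (0:R) (1:R) := HB.pack F FC FB.
pose Q : probability (measurableTypeR R) R := lebesgue_stieltjes_measure f.
exists Q => s.
have QE : Q `]-oo, s]%classic = (F s)%:E by exact: cdf_lebesgue_stieltjes_id f s.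
by rewrite -setCitvl probability_setC ?QE//.
Qed.

(** The negative half-line is a countable union of rays []-oo, - 1/(n+1)]], each null as the
    complement of a ray of mass 1. *)
Lemma probability_itv_ge0 (R : realType)
    (Q : probability (measurableTypeR R) R) :
  (forall s, s < 0 -> Q `]s, +oo[%classic = 1%E) -> Q `[0, +oo[%classic = 1%E.
Proof.
move=> Q1; rewrite -setCitvl probability_setC//.
suff -> : Q `]-oo, 0[%classic = 0%E by rewrite sube0.
apply/negligibleP => //.
have -> : `]-oo, 0[%classic = \bigcup_n `]-oo, - n.+1%:R^-1]%classic
    :> set (measurableTypeR R).
  apply/seteqP; split=> [x /=|x [n _] /=]; rewrite !in_itv/=; last first.
    by move=> /le_lt_trans; apply; rewrite oppr_lt0 invr_gt0.
  move=> /ltr_add_invr[n xn]; exists n => //=; rewrite in_itv/= lerNr -subr_le0.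
  by rewrite opprK addrC ltW.
have Q0 n : Q `]-oo, - n.+1%:R^-1]%classic = 0%E.
  have n_lt0 : - n.+1%:R^-1 < 0 :> R by rewrite oppr_lt0 invr_gt0.
  by rewrite -setCitvr probability_setC// Q1// subee.
by apply: negligible_bigcup => n; apply/negligibleP => //; exact: Q0.
Qed.

Lemma optimal_law (R : realType) (lambda : R) (G : R -> R) : 0 < lambda ->
  (forall s t : R, 0 <= s -> s < t -> G t < G s) ->
  (forall s : R, 0 <= s -> 0 < G s) ->
  (forall x : R, 0 <= x -> G y @[y --> x^'+] --> G x) ->
  (forall e : R, 0 < e -> exists2 s : R, 0 <= s & G s < e) ->
  let s0 := s_star lambda G in
  exists2 Q : probability (measurableTypeR R) R, Mplus Q &
    forall s, Q `]s, +oo[%classic =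
      (if s < s0 then 1 else Num.sqrt (2 * G s / lambda))%:E.
Proof.
move=> l0 decG posG rcG smallG s0.
have [|s0_ge0 _ Gs0] := s_star_properties R lambda G decG rcG.
  by apply: smallG; rewrite divr_gt0.
rewrite -/s0 in s0_ge0 Gs0.
pose h s := Num.sqrt (2 * G s / lambda).
have ndecG s t : 0 <= s -> s <= t -> G t <= G s.
  by move=> s_ge0; rewrite le_eqVlt => /orP[/eqP->//|/(decG _ _ s_ge0)/ltW].
have h_le1 s : s0 <= s -> h s <= 1.
  move=> /Gs0 Gs; rewrite -sqrtr1 ler_sqrt// ler_pdivrMr// mul1r.
  by rewrite mulrC -ler_pdivlMr.
have h_noninc s t : 0 <= s -> s <= t -> h t <= h s.
  move=> s_ge0 st; apply: ler_wsqrtr.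
  by rewrite ler_pM2r ?invr_gt0// ler_pM2l// ndecG.
(* The value 0 also covers negative times, which settles the limit at [-oo] and the support
   condition. A jump at [s0] is allowed: if [s0 = 0] and [G 0 < lambda / 2], the law has an atom at
   0. *)
pose F s := if s < s0 then 0 else 1 - h s.
have ndF : nondecreasing_fun F.
  move=> s t st; rewrite /F; case: (ltP t s0) => [ts0|s0t].
    by rewrite (le_lt_trans st ts0).
  case: ltP => [_|s0s]; first by rewrite subr_ge0 h_le1.
  by rewrite lerD2l lerN2 h_noninc// (le_trans s0_ge0).
have rcF : right_continuous F.
  move=> x; rewrite {2}/F; case: ltP => [xs0|s0x].
    apply: (@cvg_trans _ ((fun=> 0 : R) @ x^'+)); last exact: cvg_cst.
    apply: near_eq_cvg; near=> y.
    have ys0 : y < s0 by near: y; exact: nbhs_right_lt.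
    by rewrite /F ys0.
  have x_ge0 := le_trans s0_ge0 s0x.
  apply: (@cvg_trans _ ((fun y => 1 - h y) @ x^'+)).
    apply: near_eq_cvg; near=> y.
    have xy : x <= y by near: y; exact: nbhs_right_ge.
    by rewrite /F ltNge (le_trans s0x xy).
  apply: cvgB; first exact: cvg_cst.
  apply: (@cvg_comp _ _ _ (fun y => 2 * G y / lambda)).
    by apply: cvgMl; apply: cvgMr; exact: rcG.
  exact: sqrt_continuous.
have F0 : F @ -oo --> (0 : R).
  apply: (@cvg_trans _ ((fun=> 0 : R) @ -oo)); last exact: cvg_cst.
  apply: near_eq_cvg; near=> y.
  have ys0 : y < s0 by near: y; apply: nbhs_ninfty_lt; rewrite num_real.
  by rewrite /F ys0.
have F1 : F @ +oo --> (1 : R).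
  apply/cvgrPdist_le => e e0.
  (* This is the value of [G] at which [sqrt (2 * G / lambda)] equals [e]. *)
  have [|u u0 Gu] := smallG (lambda * e ^+ 2 / 2).
    by rewrite divr_gt0// mulr_gt0// exprn_gt0.
  near=> y.
  have y0 : s0 <= y by near: y; apply: nbhs_pinfty_ge; rewrite num_real.
  have uy : u <= y by near: y; apply: nbhs_pinfty_ge; rewrite num_real.
  have -> : 1 - F y = h y by rewrite /F ltNge y0 /= subKr.
  rewrite ger0_norm ?sqrtr_ge0// -[e]gtr0_norm// -sqrtr_sqr.
  apply: ler_wsqrtr; rewrite ler_pdivrMr//.
  by have := ndecG _ _ u0 uy; lra.
have [Q QE] := ccdf_realization R F ndF rcF F0 F1.
have QE' s : Q `]s, +oo[%classic = (if s < s0 then 1 else h s)%:E.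
  by rewrite QE /F; case: ifP => _; rewrite ?subr0 ?subKr.
exists Q => //; split=> [|s s_ge0].
  apply: probability_itv_ge0 => s s_lt0.
  by rewrite QE' (lt_le_trans s_lt0 s0_ge0).
rewrite QE' lte_fin; case: ifP => // _.
by rewrite sqrtr_gt0 divr_gt0// mulr_gt0// posG.
Unshelve. all: by end_near. Qed.

(** * The objective as one integral, its minimization and its value *)

Section objective.
Context (R : realType) (lambda : R) (G : R -> R).
Hypothesis l0 : 0 < lambda.
Hypothesis decG : forall s t : R, 0 <= s -> s < t -> G t < G s.
Hypothesis posG : forall s : R, 0 <= s -> 0 < G s.

Let mu := @lebesgue_measure R.

(** Clamping the argument at 0 turns [G] into a function monotone on the whole line. *)
Lemma measurable_decreasing_halfline : measurable_fun (`[0, +oo[ : set R) G.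
Proof.
apply: (@eq_measurable_fun _ _ R R _ (fun s => G (Num.max 0 s))).
  by move=> s; rewrite inE/= in_itv/= andbT => s0; rewrite max_r.
apply: nonincreasing_measurable => // s t st.
have : Num.max 0 s <= Num.max 0 t by rewrite ge_max !le_max lexx st orbT.
rewrite le_eqVlt => /orP[/eqP->//|lt_st].
by apply/ltW/decG => //; rewrite le_max lexx.
Qed.

Lemma Mplus_survival (Q : probability (measurableTypeR R) R) (s : R) :
  Mplus Q -> 0 <= s -> 0 < fine (Q `]s, +oo[%classic) <= 1.
Proof.
move=> [_ Qpos] s0.
have Qfin : Q `]s, +oo[%classic \is a fin_num by exact: fin_num_measure.
by rewrite -lte_fin -lee_fin fineK// Qpos//= probability_le1.
Qed.

(** Merging the two non-negative integrals reduces the comparison of laws to one between integrands,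
    also when values are infinite. *)
Lemma objectiveE (Q : probability (measurableTypeR R) R) : Mplus Q ->
  let q s := fine (Q `]s, +oo[%classic) in
  let phi s := 2 * (G s / q s) + lambda * q s in
  measurable_fun (`[0, +oo[ : set R) phi /\
  objective lambda G Q = (\int[mu]_(s in `[0%R, +oo[) (phi s)%:E)%E.
Proof.
move=> MQ q phi.
have q0 s : 0 <= s -> 0 < q s by move=> /(Mplus_survival Q _ MQ)/andP[].
have Qfin s : Q `]s, +oo[%classic \is a fin_num by exact: fin_num_measure.
have q_noninc : nonincreasing_fun q.
  move=> s t st; rewrite fine_le//.
  by apply: le_measure; rewrite ?inE//; apply: subset_itvr; rewrite bnd_simp.
(* Positivity at negative times makes the inverse of [q] monotone on the whole line, hence
   measurable. *)
have qpos s : 0 < q s.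
  have [/q0//|s0] := leP 0 s.
  by apply: lt_le_trans (q0 0 _) (q_noninc _ _ (ltW s0)).
have mq : measurable_fun (`[0, +oo[ : set R) q by exact: nonincreasing_measurable.
have mqV : measurable_fun (`[0, +oo[ : set R) (fun s => (q s)^-1).
  apply: nondecreasing_measurable => // s t st.
  by rewrite lef_pV2 ?posrE// q_noninc.
have mGq : measurable_fun (`[0, +oo[ : set R) (fun s => G s / q s).
  by apply: measurable_funM => //; exact: measurable_decreasing_halfline.
split.
  by apply: measurable_funD; apply: measurable_funM.
have Gq_ge0 s : `[0, +oo[%classic s -> 0 <= G s / q s.
  by rewrite /= in_itv/= andbT => s0; rewrite divr_ge0// ltW// posG.
under [RHS]eq_integral do rewrite EFinD !EFinM.
rewrite ge0_integralD//=; last 4 first.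
- by move=> s /Gq_ge0 ?; rewrite -EFinM lee_fin mulr_ge0.
- by apply/measurable_EFinP; apply: measurable_funM.
- by move=> s _; rewrite -EFinM lee_fin mulr_ge0// ltW.
- by apply/measurable_EFinP; apply: measurable_funM.
rewrite !ge0_integralZl_EFin//.
- rewrite /objective.
  by under [X in (_ + _ * X)%E]eq_integral do rewrite -[Q _]fineK//.
- by move=> s _; rewrite lee_fin ltW.
- exact/measurable_EFinP.
- exact: ltW.
- exact/measurable_EFinP.
Qed.

Lemma objective_min (Q Q' : probability (measurableTypeR R) R) :
  Mplus Q -> Mplus Q' ->
  (forall s, 0 <= s -> Q `]s, +oo[%classic =
    (if lambda / 2 < G s then 1 else Num.sqrt (2 * G s / lambda))%:E) ->
  (objective lambda G Q <= objective lambda G Q')%E.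
Proof.
move=> MQ MQ' QE.
have [mphi ->] := objectiveE Q MQ.
have [mphi' ->] := objectiveE Q' MQ'.
have phi_ge0 (Q1 : probability (measurableTypeR R) R) s : Mplus Q1 ->
    `[0, +oo[%classic s -> 0 <= 2 * (G s / fine (Q1 `]s, +oo[%classic)) +
                            lambda * fine (Q1 `]s, +oo[%classic).
  rewrite /= in_itv/= andbT => MQ1 s0.
  have /andP[q0 _] := Mplus_survival Q1 s MQ1 s0.
  by rewrite addr_ge0// mulr_ge0 ?divr_ge0// ltW// posG.
apply: ge0_le_integral => //.
- by move=> s s0; rewrite lee_fin phi_ge0.
- exact/measurable_EFinP.
- exact/measurable_EFinP.
move=> s /=; rewrite in_itv/= andbT => s0; rewrite lee_fin.
have /andP[q0 q1] := Mplus_survival Q' s MQ' s0.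
by rewrite QE//=; exact: optimal_survival_pointwise (posG s s0) q0 q1.
Qed.

(** The integral is split at [s0]. Before [s0] the integrand is [2 * G s + lambda]; after it, both
    summands equal [sqrt (2 * lambda * G s)]. *)
Lemma optimal_value (Q : probability (measurableTypeR R) R) (s0 : R) :
  Mplus Q -> 0 <= s0 ->
  (forall s, 0 <= s -> Q `]s, +oo[%classic =
    (if s < s0 then 1 else Num.sqrt (2 * G s / lambda))%:E) ->
  objective lambda G Q =
    (2%:E * \int[mu]_(s in `[0%R, s0]) (G s)%:E
     + (2 * Num.sqrt (2 * lambda))%:E
       * \int[mu]_(s in `[s0, +oo[) (Num.sqrt (G s))%:E
     + lambda%:E * s0%:E)%E.
Proof.
move=> MQ s0_ge0 QE.
have [mphi ->] := objectiveE Q MQ.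
have mG := measurable_decreasing_halfline.
have sub0 : `[0, s0[ `<=` (`[0, +oo[ : set R) by apply: subset_itvl.
have sub1 : `[s0, +oo[ `<=` (`[0, +oo[ : set R).
  by apply: subset_itvr; rewrite bnd_simp.
have split_itv : `[0, +oo[%classic = `[0, s0[ `|` `[s0, +oo[ :> set R.
  by rewrite -itv_bndbnd_setU// bnd_simp.
have phi0 s : `[0, s0[%classic s ->
    2 * (G s / fine (Q `]s, +oo[%classic)) + lambda * fine (Q `]s, +oo[%classic)
    = 2 * G s + lambda.
  by rewrite /= in_itv/= => /andP[s_ge0 ss0]; rewrite QE// ss0 /= divr1 mulr1.
have phi1 s : `[s0, +oo[%classic s ->
    2 * (G s / fine (Q `]s, +oo[%classic)) + lambda * fine (Q `]s, +oo[%classic)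
    = 2 * Num.sqrt (2 * lambda) * Num.sqrt (G s).
  rewrite /= in_itv/= andbT => s0s; have s_ge0 := le_trans s0_ge0 s0s.
  have Gs := posG s s_ge0.
  rewrite QE// ltNge s0s /=.
  have r0 : 0 < Num.sqrt lambda by rewrite sqrtr_gt0.
  have t0 : 0 < Num.sqrt (G s) by rewrite sqrtr_gt0.
  have w0 : 0 < Num.sqrt 2 :> R by rewrite sqrtr_gt0.
  (* Writing [G s], [lambda] and 2 as squares of their roots makes the identity rational in these
     three roots. *)
  rewrite sqrtrM ?mulr_ge0// ?ltW// sqrtrM// sqrtrV ?ltW// sqrtrM//.
  rewrite -{1}(sqr_sqrtr (ltW Gs)) -{2}(sqr_sqrtr (ltW l0)).
  have w2 : Num.sqrt 2 ^+ 2 = 2 :> R by rewrite sqr_sqrtr.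
  by rewrite -{1}w2; field; rewrite !gt_eqF.
have mG0 : measurable_fun (`[0, s0[ : set R) G by exact: measurable_funS mG.
have mG1 : measurable_fun (`[s0, +oo[ : set R) G by exact: measurable_funS mG.
rewrite split_itv ge0_integral_setU//; last 3 first.
- by rewrite -split_itv; apply/measurable_EFinP.
- move=> s; rewrite -split_itv /= in_itv/= andbT => s_ge0.
  have /andP[q0 _] := Mplus_survival Q s MQ s_ge0.
  by rewrite lee_fin addr_ge0// mulr_ge0 ?divr_ge0// ltW// posG.
- apply/disj_setPRL => s /=; rewrite !in_itv/= andbT ltNge => s0s.
  by rewrite s0s andbF.
rewrite [RHS]addeAC; congr (_ + _)%E.
  transitivity (\int[mu]_(s in `[0%R, s0[) (2%:E * (G s)%:E + lambda%:E))%E.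
    by apply: eq_integral => s /set_mem s_in; rewrite phi0// EFinD EFinM.
  rewrite ge0_integralD//=; last 3 first.
  - by move=> s s_in; rewrite -EFinM lee_fin mulr_ge0// ltW// posG// (itvP s_in).
  - by apply/measurable_EFinP; apply: measurable_funM.
  - by move=> s _; rewrite lee_fin ltW.
  rewrite ge0_integralZl_EFin//; last 2 first.
  - by move=> s s_in; rewrite lee_fin ltW// posG// (itvP s_in).
  - exact/measurable_EFinP.
  (* The endpoint [s0] is a null set, so the interval may be closed. *)
  rewrite integral_itv_bndo_bndc; last exact/measurable_EFinP.
  congr (_ + _)%E.
  have mu_s0 : mu `[0, s0[%classic = s0%:E.
    rewrite /mu lebesgue_measure_itv/= lte_fin oppr0 adde0.
    (* When the interval is empty, its length 0 is still [s0], since then [s0 = 0]. *)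
    by case: ltP => // s0_le0; congr EFin; apply/eqP; rewrite eq_le s0_ge0.
  by rewrite (integral_cst mu)// [X in (_ * X)%E]mu_s0.
transitivity (\int[mu]_(s in `[s0, +oo[)
    ((2 * Num.sqrt (2 * lambda))%:E * (Num.sqrt (G s))%:E))%E.
  by apply: eq_integral => s /set_mem s_in; rewrite phi1// EFinM.
rewrite ge0_integralZl_EFin//.
apply/measurable_EFinP; apply: measurableT_comp => //.
by apply: continuous_measurable_fun; exact: sqrt_continuous.
Qed.
End objective.

Theorem theorem1 (R : realType) (d : measure_display) (Omega : measurableType d)
    (P : probability Omega R) (S : metricType R) (X : R -> Omega -> S)
    (g : S -> R -> R) (lambda : R) :
  stochastic_process X ->
  jointly_measurable X g ->
  square_integrable_total P X g ->
  Gamma_converges P X g ->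
  0 < lambda ->
  let G := Gamma P X g in
  (forall s : R, 0 <= s -> 0 <= G s) ->
  (forall s t : R, 0 <= s -> s < t -> G t < G s) ->
  smooth_halfline G ->
  let s0 := s_star lambda G in
  exists Qs : probability (measurableTypeR R) R,
    [/\ Mplus Qs,
        forall s : R, 0 <= s ->
          Qs `]s, +oo[%classic =
            (if s < s0 then 1 else Num.sqrt (2 * G s / lambda))%:E,
        ereal_inf [set objective lambda G Q | Q in @Mplus R]
          = objective lambda G Qs
      & objective lambda G Qs =
          (2%:E * \int[lebesgue_measure]_(s in `[0%R, s0]) (G s)%:E
           + (2 * Num.sqrt (2 * lambda))%:E
               * \int[lebesgue_measure]_(s in `[s0, +oo[) (Num.sqrt (G s))%:E
           + lambda%:E * s0%:E)%E].
Proof.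
move=> _ mg sqX cvG l0 G G_ge0 decG smoothG s0.
have smallG e : 0 < e -> exists2 s : R, 0 <= s & G s < e.
  exact: Gamma_arbitrarily_small.
(* Strict decrease puts [G s] above the non-negative value [G (s + 1)]. *)
have posG s : 0 <= s -> 0 < G s.
  move=> s_ge0; have s1 : s < s + 1 by rewrite ltrDl.
  by apply: le_lt_trans (decG s _ s_ge0 s1); rewrite G_ge0// addr_ge0.
have rcG x (x0 : 0 <= x) := smooth_halfline_right_cvg R G x smoothG x0.
have [Q MQ QE] := optimal_law R lambda G l0 decG posG rcG smallG.
have [|s0_ge0 G_gt G_le] := s_star_properties R lambda G decG rcG.
  by apply: smallG; rewrite divr_gt0.
exists Q; split => //; last exact: optimal_value.
apply/le_anti/andP; split; first by apply: ereal_inf_lbound; exists Q.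
apply: le_ereal_inf_tmp => _ [Q' MQ' <-]; apply: objective_min => // s s_ge0.
(* The law is described by the test [s < s0], the pointwise minimizer by [lambda / 2 < G s]; the
   threshold properties identify the two. *)
rewrite QE; congr (if _ then _ else _)%:E; case: ltP => [ss0|s0s].
  by rewrite G_gt.
by rewrite ltNge G_le.
Qed.
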